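(* Let $K$ be a field, let $n\ge 3$, $1\le i_1,i_2\le n-2$ and $0\le t_2\le n-1$ be integers. Let $\mathcal{A}=\{A_1,\dots,A_n\}$ and $\mathcal{B}=\{B_1,\dots,B_n\}$ be the families of subsets of $[n]$ given by $$A_k=[n]\ \text{ if } k\in[i_1]\cup\{n\},\qquad A_k=[n]\setminus[i_1]\ \text{ if } k\in[n-1]\setminus[i_1],$$ $$B_{\sigma^{t_2}(k)}=[n]\ \text{ if } k\in[i_2]\cup\{n\},\qquad B_{\sigma^{t_2}(k)}=[n]\setminus\sigma^{t_2}[i_2]\ \text{ if } k\in[n-1]\setminus[i_2].$$ Let $A=\{e_{j_1}+\dots+e_{j_n}: j_k\in A_k,\ 1\le k\le n\}$ and $B=\{e_{j_1}+\dots+e_{j_n}: j_k\in B_k,\ 1\le k\le n\}$ be the sets of exponent vectors of the monomials defining the base rings of the transversal polymatroids presented by $\mathcal{A}$ and $\mathcal{B}$, and let $K[A\cap B]$ be the $K$-subalgebra of $K[x_1,\dots,x_n]$ generated by the monomials $x^\alpha$ with $\alpha\in A\cap B$. Then $K[A\cap B]$ is the base ring associated to a transversal polymatroid if and only if one of the following conditions holds: (a) $i_1=1$; (b) $i_1\ge 2$ and $t_2=0$; (c) $i_1\ge 2$ and $t_2=i_1$; (d) $i_1\ge 2$, $1\le t_2\le i_1-1$ and $i_2\in\{1,\dots,i_1-t_2\}\cup\{n-t_2,\dots,n-2\}$; (e) $i_1\ge 2$, $i_1+1\le t_2\le n-1$ and $i_2\in\{1,\dots,n-t_2\}\cup\{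n-t_2+i_1,\dots,n-2\}$.
   Context: $[m]=\{1,\dots,m\}$. $\sigma=(1,2,\dots,n)\in S_n$ is the cycle of length $n$ (so $\sigma(k)=k+1$ for $k<n$ and $\sigma(n)=1$), and $\sigma^{t}[i]=\{\sigma^t(1),\dots,\sigma^t(i)\}$. $e_1,\dots,e_n$ is the canonical basis of $\mathbb{R}^n$, and $x^\alpha=x_1^{\alpha_1}\cdots x_n^{\alpha_n}$. A set of the form $\{a,\dots,b\}$ with $a>b$ is empty. For $m\ge 2$ and a family $\mathcal{C}=\{C_1,\dots,C_m\}$ of (not necessarily distinct) nonempty subsets of $[n]$, the set of vectors $\sum_{k=1}^m e_{j_k}$ with $j_k\in C_k$ is the base of a polymatroid, called the transversal polymatroid presented by $\mathcal{C}$. Its base ring is the $K$-subalgebra $K[\mathcal{C}]=K[x_{j_1}\cdots x_{j_m} : j_k\in C_k,\ 1\le k\le m]$ of $K[x_1,\dots,x_n]$. ''$K[A\cap B]$ is the base ring associated to a transversal polymatroid'' means that there is such a family $\mathcal{C}$ with $K[A\cap B]=K[\mathcal{C}]$ as subalgebras of $K[x_1,\dots,x_n]$. *)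

(* Defs.v *)
From mathcomp Require Import all_boot all_order all_fingroup all_algebra.
From mathcomp Require Import mpoly.

Set Implicit Arguments.
Unset Strict Implicit.
Unset Printing Implicit Defensive.

Import GRing.Theory.
Local Open Scope ring_scope.

(* Throughout, the element k of {1, ..., n} is the ordinal k - 1 : 'I_n. *)

(* The set [i] = {1, ..., i}. *)
Definition initseg (n i : nat) : {set 'I_n} := [set k : 'I_n | (k < i)%N].

(* The cycle (1, 2, ..., n): [ordS k] is (k + 1) mod n. *)
Definition sigma (n : nat) : 'S_n := perm (@ordS_inj n).

(* The closure conditions are those of [GRing.subalg_closed], for a predicate
   valued in Prop. *)
Inductive subalgebra_gen (R : comNzRingType) (L : algType R) (S : L -> Prop) :
    L -> Prop :=
| Subalg_gen u : S u -> subalgebra_gen S u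
| Subalg_one : subalgebra_gen S 1
| Subalg_lin c u v :
    subalgebra_gen S u -> subalgebra_gen S v -> subalgebra_gen S (c *: u + v)
| Subalg_mul u v :
    subalgebra_gen S u -> subalgebra_gen S v -> subalgebra_gen S (u * v).

Definition transversal_exponents (n m : nat) (C : 'I_m -> {set 'I_n})
    (a : 'X_{1..n}) : Prop :=
  exists2 j : 'I_m -> 'I_n,
    forall k, j k \in C k & a = (\sum_(k < m) U_(j k))%MM.

Definition monomial_subalgebra (K : fieldType) (n : nat)
    (S : 'X_{1..n} -> Prop) : {mpoly K[n]} -> Prop :=
  subalgebra_gen (fun p : {mpoly K[n]} => exists2 a, S a & p = 'X_[a]).

Definition base_ring (K : fieldType) (n m : nat) (C : 'I_m -> {set 'I_n}) :
    {mpoly K[n]} -> Prop :=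
  subalgebra_gen (fun p : {mpoly K[n]} =>
    exists2 j : 'I_m -> 'I_n, forall k, j k \in C k & p = \prod_(k < m) 'X_(j k)).

Arguments monomial_subalgebra K {n} S _.
Arguments base_ring K {n m} C _.

Definition is_transversal_base_ring (K : fieldType) (n : nat)
    (P : {mpoly K[n]} -> Prop) : Prop :=
  exists (m : nat) (C : 'I_m -> {set 'I_n}),
    [/\ (2 <= m)%N, forall k, C k != set0 & forall p, P p <-> base_ring K C p].

(* Main.v *)
Require Import Defs.
From mathcomp Require Import all_boot all_order all_fingroup all_algebra.
From mathcomp Require Import mpoly zify.

(* Put [I = [i1]] and [J = sigma^t2 [i2]]. The exponents in [A :&: B] are the
   vectors of degree [n] with [mass I <= i1 + 1] and [mass J <= i2 + 1], and a
   subalgebra generated by monomials of one positive degree determines those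
   monomials. The conditions (a)-(e) say that [I] and [J] are nested, disjoint or
   cover ['I_n]. In those cases the exponents can be listed so that [I] comes first
   and [J] comes first (nested) or last (otherwise), so it suffices to forbid [I],
   resp. [J], to the appropriate positions.
   Otherwise there are [w] in [I :&: J], [x] in [I :\: J], [y] in [J :\: I] and [z]
   outside both. In a presentation by sets [C_k], if [i1 <= i2] then the [C_k]
   meeting [I], those containing [w] and those containing [x] are the same, so
   every [C_k] meeting [{x, y}] meets [J]; but [{x, y}] supports mass
   [min n (i1 + i2 + 2)], which exceeds the bound [i2 + 1] for [J]. *)

Set Implicit Arguments.
Unset Strict Implicit.
Unset Printing Implicit Defensive.

(** * Mass of an exponent vector on a set of variables *)

Definition mass n (S : {set 'I_n}) (a : 'X_{1..n}) := \sum_(v in S) a v.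

Lemma mass_sumU n m (S : {set 'I_n}) (j : 'I_m -> 'I_n) :
  mass S (\sum_(k < m) U_(j k))%MM = #|[set k | j k \in S]|.
Proof.
rewrite /mass (eq_bigr (fun v => \sum_(k < m) (j k == v))); last first.
  by move=> v _; rewrite mnm_sumE; apply: eq_bigr => k _; rewrite mnm1E.
rewrite exchange_big /= -sum1dep_card [RHS]big_mkcond /=.
apply: eq_bigr => k _; case: ifP => jkS.
  rewrite (bigD1 (j k)) //= eqxx big1 // => v /andP[_ /negPf].
  by rewrite eq_sym => ->.
by rewrite big1 // => v vS; case: eqP => // jkv; rewrite jkv vS in jkS.
Qed.

Lemma mass_MU n (S : {set 'I_n}) v c :
  mass S (U_(v) *+ c)%MM = (v \in S) * c.
Proof.
rewrite /mass; case: (boolP (v \in S)) => vS.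
  rewrite (bigD1 v) //= mulmnE mnm1E eqxx big1 ?addn0 // => u /andP[_ /negPf].
  by rewrite mulmnE mnm1E eq_sym => ->.
rewrite big1 // => u uS; rewrite mulmnE mnm1E.
by case: eqP => // vu; rewrite vu uS in vS.
Qed.

Lemma massD n (S : {set 'I_n}) a b : mass S (a + b)%MM = mass S a + mass S b.
Proof. by rewrite /mass -big_split; apply: eq_bigr => v _; rewrite mnmDE. Qed.

Lemma mdeg_sumU n m (j : 'I_m -> 'I_n) : mdeg (\sum_(k < m) U_(j k))%MM = m.
Proof.
rewrite mdeg_sum (eq_bigr (fun => 1)) ?sum1_card ?card_ord // => k _.
exact: mdeg1.
Qed.

Lemma massC n (S : {set 'I_n}) a : mass (~: S) a + mass S a = mdeg a.
Proof.
rewrite mdegE (bigID (mem S)) /= addnC; congr (_ + _).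
by apply: eq_bigl => v; rewrite inE.
Qed.

(** * Listing the variables of an exponent vector in the order of a key *)

(** List each variable [v] with multiplicity [a v] and sort the list by [g]; its length is
    [mdeg a]. *)
Lemma ordered_selection n m (a : 'X_{1..n}) (g : 'I_n -> nat) :
  mdeg a = m ->
  exists2 j : 'I_m -> 'I_n, a = (\sum_(k < m) U_(j k))%MM &
    {homo j : k l / k <= l >-> g k <= g l}.
Proof.
pose s := sort (relpre g leq) (flatten [seq nseq (a v) v | v <- enum 'I_n]).
have size_s : size s = mdeg a.
  rewrite size_sort size_flatten /shape -map_comp sumnE big_map mdegE big_enum.
  by apply: eq_bigr => v _; rewrite /= size_nseq.
move=> <-; rewrite -size_s; exists (tnth (in_tuple s)).
  apply/mnmP => u; rewrite mnm_sumE.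
  rewrite (eq_bigr (fun k => (tnth (in_tuple s) k == u) : nat)); last first.
    by move=> k _; rewrite mnm1E.
  rewrite -(big_tnth _ _ s xpredT (fun v => (v == u) : nat)).
  rewrite (perm_big _ (permEl (perm_sort _ _))) big_flatten big_map big_enum /=.
  rewrite (bigD1 u) //= big_nseq eqxx iter_addn mul1n addn0 big1 ?addn0 //.
  by move=> v /negPf vu; rewrite big_nseq vu iter_addn.
move=> k l kl; have v0 := tnth (in_tuple s) k; rewrite !(tnth_nth v0).
apply: (@sorted_leq_nth _ (relpre g leq)) => //.
- by move=> x y z; apply: leq_trans.
- by move=> x; apply: leqnn.
- by apply: sort_sorted => x y; apply: leq_total.
- by rewrite inE ltn_ord.
- by rewrite inE ltn_ord.
Qed.

Lemma card_initseg n i : i <= n -> #|initseg n i| = i.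
Proof.
move=> lein; rewrite -sum1dep_card -(big_ord_widen n (fun=> 1) lein).
by rewrite sum1_card card_ord.
Qed.

(** Here [S] is a lower set for the key: if position [k] selects from [S], so do all [k.+1]
    positions up to [k]. *)
Lemma selection_initial n m (j : 'I_m -> 'I_n) g c (S : {set 'I_n}) :
  {homo j : k l / k <= l >-> g k <= g l} ->
  (forall v, (v \in S) = (g v <= c)) ->
  forall k, j k \in S -> k < mass S (\sum_(k < m) U_(j k))%MM.
Proof.
move=> gj Sg k; rewrite Sg => gk; rewrite mass_sumU -(card_initseg (ltn_ord k)).
apply: subset_leq_card; apply/subsetP => l; rewrite !inE ltnS => lk.
by rewrite Sg (leq_trans _ gk) // gj.
Qed.

(** Dually, [S] is an upper set: if position [k] selects from [S], every position selecting outside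
    [S] precedes [k]. *)
Lemma selection_final n m (j : 'I_m -> 'I_n) g c (S : {set 'I_n}) :
  {homo j : k l / k <= l >-> g k <= g l} ->
  (forall v, (v \in S) = (c < g v)) ->
  forall k, j k \in S -> m <= k + mass S (\sum_(k < m) U_(j k))%MM.
Proof.
move=> gj Sg k jkS; set a := (\sum_(k < m) _)%MM.
have := massC S a; rewrite mdeg_sumU => massm.
rewrite -[X in X <= _]massm leq_add2r mass_sumU.
rewrite -[X in _ <= X](card_initseg (ltnW (ltn_ord k))).
apply: subset_leq_card; apply/subsetP => l; rewrite !inE => /negP jl.
rewrite ltnNge; apply/negP => kl; apply: jl.
by move: jkS; rewrite !Sg => /leq_trans; apply; apply: gj.
Qed.

(** * Families made of full sets and copies of one complement *)

Lemma transversal_mdeg n m (C : 'I_m -> {set 'I_n}) a :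
  transversal_exponents C a -> mdeg a = m.
Proof. by case=> j _ ->; apply: mdeg_sumU. Qed.

Lemma transversal_reindex n m (C D : 'I_m -> {set 'I_n}) (s : 'S_m) a :
  (forall k, D (s k) = C k) ->
  transversal_exponents C a -> transversal_exponents D a.
Proof.
move=> DC [j jC ->]; exists (j \o (s^-1)%g) => [k|].
  by have := jC ((s^-1)%g k); rewrite -DC permKV.
by rewrite [RHS](reindex_inj (@perm_inj _ s)); apply: eq_bigr => k _ /=; rewrite permK.
Qed.

Lemma perm_onto_set n (T : {set 'I_n}) :
  exists s : 'S_n, forall k, (s k \in T) = (k < #|T|).
Proof.
pose e := enum T ++ enum (~: T).
have size_e : size e = n.
  by rewrite size_cat -!cardE cardsC card_ord.
have uniq_e : uniq e.
  rewrite cat_uniq !enum_uniq andbT /=; apply/hasPn => v.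
  by rewrite /= !mem_enum inE.
(* The default value [k] is never returned, since [e] has length [n]. *)
have inj_e : injective (fun k : 'I_n => nth k e k).
  move=> k l /eqP; rewrite (set_nth_default k l) ?size_e //.
  by rewrite nth_uniq ?size_e // => /eqP /val_inj.
exists (perm inj_e) => k; rewrite permE nth_cat -cardE.
case: ltnP => kT; first by rewrite -mem_enum mem_nth // -cardE.
apply/negbTE; have: nth k (enum (~: T)) (k - #|T|) \in enum (~: T).
  rewrite mem_nth // -cardE [X in _ < X]cardsCs setCK card_ord ltn_sub2r //.
  exact: leq_ltn_trans kT _.
by rewrite mem_enum inE.
Qed.

(** Only positions in [T] can select from [I], hence the bound. Conversely, list [I] first: the
    selections from [I] fall in the first [#|T|] positions, which a permutation carries onto [T]. *)
Lemma two_block_exponents n (C : 'I_n -> {set 'I_n}) (I T : {set 'I_n}) a :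
  (forall k, C k = if k \in T then [set: 'I_n] else ~: I) ->
  transversal_exponents C a <-> mdeg a = n /\ mass I a <= #|T|.
Proof.
move=> CT; split=> [[j jC ->]|[mdega massa]].
  rewrite mdeg_sumU mass_sumU; split=> //; apply: subset_leq_card.
  apply/subsetP => k; rewrite inE => jkI; apply/negPn/negP => /negPf kT.
  by have := jC k; rewrite CT kT inE jkI.
have [j aj gj] := ordered_selection (fun v => (v \notin I) : nat) mdega.
have [s sT] := perm_onto_set T.
apply: (@transversal_reindex _ _ (fun k => C (s k)) _ s) => //.
exists j => // k; rewrite CT sT; case: ltnP => Tk; rewrite inE //.
apply/negP => jkI; have := selection_initial (c := 0) gj _ jkI.
rewrite -aj ltnNge (leq_trans massa Tk) => H; apply: notF; apply: H.
by move=> v; case: (v \in I).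
Qed.

(** * Presentations when the two sets are nested, disjoint or covering *)

(* [I] comes first and [J] last in the order of the key [(v \notin I) + (v \in J)]. *)
Lemma separated_selection n (I J : {set 'I_n}) (a : 'X_{1..n}) :
  [disjoint I & J] \/ I :|: J = setT -> mdeg a = n ->
  exists j : 'I_n -> 'I_n, [/\ a = (\sum_(k < n) U_(j k))%MM,
    forall k, j k \in I -> k < mass I a &
    forall k, j k \in J -> n <= k + mass J a].
Proof.
move=> IJ mdega.
have [j aj gj] := ordered_selection (fun v => (v \notin I) + (v \in J)) mdega.
have {}IJ : (forall v, v \in I -> v \notin J) \/ (forall v, v \notin I -> v \in J).
  case: IJ => [dIJ|cIJ]; [left|right] => v.
    by move=> vI; rewrite (disjointFr dIJ vI).
  by move/setP/(_ v): cIJ; rewrite !inE => /orP[->|].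
(* In the disjoint case the key is 0 on [I], 1 outside both and 2 on [J]. In the covering case it is
   0 on [I :\: J], 1 on [I :&: J] and 2 on [J :\: I]. *)
have [c Ic Jc] : exists2 c, forall v, (v \in I) = ((v \notin I) + (v \in J) <= c) &
    forall v, (v \in J) = (1 - c < (v \notin I) + (v \in J)).
  case: IJ => [dIJ|cIJ]; [exists 0|exists 1] => v.
  - by move: (dIJ v); case: (v \in I); case: (v \in J) => // /(_ isT).
  - by move: (dIJ v); case: (v \in I); case: (v \in J) => // /(_ isT).
  - by move: (cIJ v); case: (v \in I); case: (v \in J) => // /(_ isT).
  - by move: (cIJ v); case: (v \in I); case: (v \in J) => // /(_ isT).
exists j; split=> // k; rewrite aj.
  exact: selection_initial gj Ic k.
exact: selection_final gj Jc k.
Qed.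

(** The key is 0 on [J], 1 on [I :\: J] and 2 outside [I], so both sets are lower sets. *)
Lemma nested_selection n (I J : {set 'I_n}) (a : 'X_{1..n}) :
  J \subset I -> mdeg a = n ->
  exists j : 'I_n -> 'I_n, [/\ a = (\sum_(k < n) U_(j k))%MM,
    forall k, j k \in I -> k < mass I a &
    forall k, j k \in J -> k < mass J a].
Proof.
move=> /subsetP JI mdega.
have [j aj gj] := ordered_selection (fun v => (v \notin I) + (v \notin J)) mdega.
exists j; split=> // k; rewrite aj.
  apply: (selection_initial (c := 1) gj) => v.
  by move: (JI v); case: (v \in I); case: (v \in J) => // /(_ isT).
apply: (selection_initial (c := 0) gj) => v.
by move: (JI v); case: (v \in I); case: (v \in J) => // /(_ isT).
Qed.

Definition two_bounds n (I J : {set 'I_n}) a b (x : 'X_{1..n}) :=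
  [/\ mdeg x = n, mass I x <= a & mass J x <= b].

Lemma two_boundsC n (I J : {set 'I_n}) a b x :
  two_bounds I J a b x <-> two_bounds J I b a x.
Proof. by split=> -[? ? ?]; split. Qed.

Lemma mass_sumU_le n m (S : {set 'I_n}) (j : 'I_m -> 'I_n) (T : {set 'I_m}) :
  (forall k, j k \in S -> k \in T) -> mass S (\sum_(k < m) U_(j k))%MM <= #|T|.
Proof.
move=> ST; rewrite mass_sumU; apply: subset_leq_card; apply/subsetP => k.
by rewrite inE; apply: ST.
Qed.

Lemma exists_notin n (S : {set 'I_n}) : #|S| < n -> exists z, z \notin S.
Proof.
move=> Sn; have /set0Pn[z] : ~: S != set0.
  by rewrite -card_gt0 cardsCs setCK card_ord subn_gt0.
by rewrite inE; exists z.
Qed.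

(** Allow [I] in the first [a] positions only and [J] in the first [b] only; a point outside [I] is
    then allowed everywhere. *)
Lemma transversal_nested n (I J : {set 'I_n}) a b :
  J \subset I -> #|I| < n -> a <= n -> b <= n ->
  exists2 C : 'I_n -> {set 'I_n}, forall k, C k != set0 &
    forall x, transversal_exponents C x <-> two_bounds I J a b x.
Proof.
move=> JI In an bn.
exists (fun k : 'I_n => [set v | ((v \in I) ==> (k < a)) && ((v \in J) ==> (k < b))]).
  have [z zI] := exists_notin In; move=> k; apply/set0Pn; exists z; rewrite inE.
  by rewrite (negPf zI) /=; apply/implyP => /(subsetP JI); rewrite (negPf zI).
move=> x; split=> [[j jC ->]|[mdegx xI xJ]].
  split; first exact: mdeg_sumU.
    rewrite -(card_initseg an); apply: mass_sumU_le => k jkI.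
    by have := jC k; rewrite !inE jkI => /andP[].
  rewrite -(card_initseg bn); apply: mass_sumU_le => k jkJ.
  by have := jC k; rewrite !inE jkJ => /andP[].
have [j [xj jI jJ]] := nested_selection JI mdegx; exists j => // k.
rewrite inE; apply/andP; split; apply/implyP => jk.
  exact: leq_trans (jI _ jk) xI.
exact: leq_trans (jJ _ jk) xJ.
Qed.

(** Allow [I] in the first [a] positions only and [J] in the last [b] only. *)
Lemma transversal_separated n (I J : {set 'I_n}) a b :
  [disjoint I & J] \/ I :|: J = setT -> #|I| < a <= n -> #|J| < b <= n ->
  exists2 C : 'I_n -> {set 'I_n}, forall k, C k != set0 &
    forall x, transversal_exponents C x <-> two_bounds I J a b x.
Proof.
move=> IJ /andP[Ia an] /andP[Jb bn].
exists (fun k : 'I_n =>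
    [set v | ((v \in I) ==> (k < a)) && ((v \in J) ==> (n <= k + b))]).
  move=> k; apply/set0Pn; case: (ltnP k a) => ka; last first.
    case: (leqP n (k + b)) => kb; last first.
      (* This position forbids both sets, so [a + b < n] and [I :|: J] cannot be everything. *)
      have [|z] := @exists_notin _ (I :|: J).
        apply: leq_ltn_trans (leq_of_leqif (leq_card_setU I J)) _.
        by lia.
      rewrite inE negb_or => /andP[zI zJ].
      by exists z; rewrite inE (negPf zI) (negPf zJ).
    have [z zI] := exists_notin (leq_trans Ia an).
    by exists z; rewrite inE (negPf zI) implybT.
  have [z zJ] := exists_notin (leq_trans Jb bn).
  by exists z; rewrite inE (negPf zJ) implybT.
move=> x; split=> [[j jC ->]|[mdegx xI xJ]].
  split; first exact: mdeg_sumU.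
    rewrite -(card_initseg an); apply: mass_sumU_le => k jkI.
    by have := jC k; rewrite !inE jkI => /andP[].
  have -> : b = #|~: initseg n (n - b)|.
    by rewrite cardsCs setCK card_initseg ?card_ord ?leq_subr ?subKn.
  apply: mass_sumU_le => k jkJ; have := jC k.
  by rewrite !inE jkJ -leqNgt leq_subLR addnC => /andP[].
have [j [xj jI jJ]] := separated_selection IJ mdegx; exists j => // k.
rewrite inE; apply/andP; split; apply/implyP => jk.
  exact: leq_trans (jI _ jk) xI.
by apply: leq_trans (jJ _ jk) _; rewrite leq_add2l.
Qed.

(** * The obstruction for crossing sets *)

(** For nonempty sets [C k], its size is the largest mass on [S] of a transversal exponent: the rank
    function of the polymatroid. *)
Definition hitters n m (C : 'I_m -> {set 'I_n}) (S : {set 'I_n}) : {set 'I_m} :=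
  [set k | C k :&: S != set0].

Lemma mass_le_hitters n m (C : 'I_m -> {set 'I_n}) S x :
  transversal_exponents C x -> mass S x <= #|hitters C S|.
Proof.
case=> j jC ->; apply: mass_sumU_le => k jkS; rewrite inE; apply/set0Pn.
by exists (j k); rewrite inE jC.
Qed.

(** Selecting from [S] wherever possible gives an exponent whose mass on [S] reaches
    [#|hitters C S|]. *)
Lemma hitters_le n m (C : 'I_m -> {set 'I_n}) S c :
  (forall k, C k != set0) ->
  (forall x, transversal_exponents C x -> mass S x <= c) -> #|hitters C S| <= c.
Proof.
move=> C0 maxS.
have chooseP k : exists v, (v \in C k) && ((k \in hitters C S) ==> (v \in S)).
  rewrite inE; case: (boolP (_ != set0)) => [/set0Pn[v]|_].
    by rewrite inE => vCS; exists v.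
  by have /set0Pn[v vC] := C0 k; exists v; rewrite vC.
pose j k := xchoose (chooseP k).
have jP k : (j k \in C k) && ((k \in hitters C S) ==> (j k \in S)) :=
  xchooseP (chooseP k).
have jC : transversal_exponents C (\sum_(k < m) U_(j k))%MM.
  by exists j => // k; case/andP: (jP k).
apply: leq_trans (maxS _ jC); rewrite mass_sumU; apply: subset_leq_card; apply/subsetP => k kS.
by have /andP[_ /implyP /(_ kS)] := jP k; rewrite inE.
Qed.

Lemma crossing_not_transversal n (I J : {set 'I_n}) a b (w x y z : 'I_n)
    (C : 'I_n -> {set 'I_n}) :
  0 < a -> a <= b -> b < n -> (forall k, C k != set0) ->
  w \in I -> w \in J -> x \in I -> x \notin J -> y \notin I -> y \in J ->
  z \notin I -> z \notin J ->
  ~ (forall u, transversal_exponents C u <-> two_bounds I J a b u).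
Proof.
move=> a0 ab bn C0 wI wJ xI xJ yI yJ zI zJ CP.
have hitI : #|hitters C I| <= a by apply: hitters_le => // u /CP[].
have hitJ : #|hitters C J| <= b by apply: hitters_le => // u /CP[].
(* Test vectors supported on at most three points. *)
have bounds_deg p q r c d e (u := (U_(p) *+ c + U_(q) *+ d + U_(r) *+ e)%MM) :
    c + d + e = n -> (p \in I) * c + (q \in I) * d + (r \in I) * e <= a ->
    (p \in J) * c + (q \in J) * d + (r \in J) * e <= b -> transversal_exponents C u.
  move=> deg hI hJ; apply/CP; split; rewrite ?massD ?mass_MU //.
  by rewrite !mdegD !mdegMn !mdeg1 !mul1n.
(* Tested on [a] copies of [v] padded by [z]. With [hitI] it follows that the sets containing [v]
   are exactly those meeting [I]. *)
have hit1 v : v \in I -> a <= #|hitters C [set v]|.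
  move=> vI.
  apply: leq_trans (mass_le_hitters _ (bounds_deg v z z a (n - a) 0 _ _ _)).
  - by rewrite !massD !mass_MU inE eqxx mul1n -addnA leq_addr.
  - by rewrite addn0 subnKC // ltnW // (leq_ltn_trans ab).
  - by rewrite vI (negPf zI) mul1n !mul0n !addn0.
  (* If [v] lies in [J], the bound is [a <= b]. *)
  - by rewrite (negPf zJ) !mul0n !addn0; case: (v \in J); rewrite ?mul1n ?mul0n.
have mono (S T : {set 'I_n}) : S \subset T -> hitters C S \subset hitters C T.
  move=> ST; apply/subsetP => k; rewrite !inE => /set0Pn[v]; rewrite inE => /andP[vC vS].
  by apply/set0Pn; exists v; rewrite inE vC (subsetP ST).
have hit1I v : v \in I -> hitters C [set v] = hitters C I.
  move=> vI; apply/eqP; rewrite eqEcard mono ?sub1set //=.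
  exact: leq_trans (hit1 v vI).
(* The left side is [minn (a + b) n]: [a] copies of [x], as many of [y] as the bound and the degree
   allow, the rest [z]. *)
have hitxy : a + minn b (n - a) <= #|hitters C [set x; y]|.
  have xyz := bounds_deg x y z a (minn b (n - a)) (n - a - minn b (n - a)).
  apply: leq_trans (mass_le_hitters _ (xyz _ _ _)).
  - by rewrite !massD !mass_MU !inE !eqxx orbT !mul1n leq_addr.
  - by lia.
  - by rewrite xI (negPf yI) (negPf zI) mul1n !mul0n !addn0.
  - by rewrite (negPf xJ) yJ (negPf zJ) mul1n !mul0n addn0 geq_minl.
have : #|hitters C [set x; y]| <= #|hitters C J|.
  apply: subset_leq_card; apply/subsetP => k; rewrite inE => /set0Pn[v].
  rewrite in_setI in_set2 => /andP[vC /orP[] /eqP vE].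
    (* A set containing [x] meets [I], hence contains [w], which lies in [J]. *)
    have : k \in hitters C [set x].
      by rewrite inE; apply/set0Pn; exists v; rewrite !inE vC vE eqxx.
    by rewrite hit1I // -(hit1I w) //; apply: (subsetP (mono _ _ _)); rewrite sub1set.
  by rewrite inE; apply/set0Pn; exists v; rewrite inE vC vE.
(* Now [minn (a + b) n <= b], against [0 < a] and [b < n]. *)
move/(leq_trans hitxy)/leq_trans/(_ hitJ); lia.
Qed.

(** * Recovering the generating monomials from the subalgebra *)

Lemma subalgebra_gen_sub (R : comNzRingType) (L : algType R) (S S' : L -> Prop) u :
  (forall v, S v -> S' v) -> subalgebra_gen S u -> subalgebra_gen S' u.
Proof.
move=> SS'; elim=> {u} [u /SS' | | c u v _ + _ | u v _ + _].
- exact: Subalg_gen.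
- exact: Subalg_one.
- exact: Subalg_lin.
- exact: Subalg_mul.
Qed.

Lemma base_ringE (K : fieldType) n m (C : 'I_m -> {set 'I_n}) p :
  base_ring K C p <-> monomial_subalgebra K (transversal_exponents C) p.
Proof.
split; apply: subalgebra_gen_sub => q.
  by case=> j jC ->; exists (\sum_(k < m) U_(j k))%MM; [exists j | rewrite mprodXE].
by case=> _ [j jC ->] ->; exists j => //; rewrite mprodXE.
Qed.

(** A product of monomials either has a constant factor or adds two exponents of degree at least
    [d], so below degree [d + d] only 0 and the generators occur. *)
Lemma monomial_subalgebra_support (K : fieldType) n d (E : 'X_{1..n} -> Prop) p :
  (forall x, E x -> mdeg x = d) -> monomial_subalgebra K E p ->
  forall x, x \in msupp p -> [\/ x = 0%MM, E x | d + d <= mdeg x].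
Proof.
move=> Ed; elim=> {p} [p [x Ex ->] | | c p q _ IHp _ IHq | p q _ IHp _ IHq] y.
- by rewrite msuppX inE => /eqP ->; constructor 2.
- by rewrite -mpolyC1 msupp1 inE => /eqP ->; constructor 1.
- by move/msuppD_le; rewrite mem_cat => /orP[/msuppZ_le /IHp | /IHq].
move/msuppM_le/allpairsP => [[u v] /= [/IHp Hu /IHq Hv ->]].
have [-> | u0] := eqVneq u 0%MM; first by rewrite add0m.
have [-> | v0] := eqVneq v 0%MM; first by rewrite addm0.
constructor 3; rewrite mdegD.
have le_d t : t != 0%MM -> [\/ t = 0%MM, E t | d + d <= mdeg t] -> d <= mdeg t.
  by move=> /eqP t0 [//|/Ed ->|]; lia.
by apply: leq_add; apply: le_d.
Qed.

(** The degrees are not assumed equal. If [x] were not in [E], then [e + e <= d]; but a member of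
    [E] gives [d = e] or [d + d <= e]. *)
Lemma monomial_subalgebra_exponents (K : fieldType) n d e (D E : 'X_{1..n} -> Prop) :
  0 < d -> 0 < e -> (forall x, D x -> mdeg x = d) -> (forall x, E x -> mdeg x = e) ->
  (exists x, E x) ->
  (forall p, monomial_subalgebra K D p <-> monomial_subalgebra K E p) ->
  forall x, D x -> E x.
Proof.
move=> d0 e0 Dd Ee [y Ey] DE x Dx.
have gen (F : 'X_{1..n} -> Prop) t : F t -> monomial_subalgebra K F 'X_[t].
  by move=> Ft; apply: Subalg_gen; exists t.
have suppX (t : 'X_{1..n}) : t \in msupp ('X_[t] : {mpoly K[n]}) by rewrite msuppX inE.
have /DE/(monomial_subalgebra_support Ee)/(_ x (suppX x)) := gen _ _ Dx.
have /DE/(monomial_subalgebra_support Dd)/(_ y (suppX y)) := gen _ _ Ey.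
case=> [y0|Dy|dy].
- by move: (Ee _ Ey); rewrite y0 mdeg0 => e00; rewrite -e00 in e0.
- case=> [x0|//|ex].
    by move: (Dd _ Dx); rewrite x0 mdeg0 => d00; rewrite -d00 in d0.
  by move: (Dd _ Dx) (Dd _ Dy) (Ee _ Ey); lia.
case=> [x0|//|ex]; last by move: (Dd _ Dx) (Ee _ Ey); lia.
by move: (Dd _ Dx); rewrite x0 mdeg0 => d00; rewrite -d00 in d0.
Qed.

Lemma monomial_subalgebra_eq (K : fieldType) n (D E : 'X_{1..n} -> Prop) p :
  (forall x, D x <-> E x) -> monomial_subalgebra K D p <-> monomial_subalgebra K E p.
Proof.
by move=> DE; split; apply: subalgebra_gen_sub => _ [x /DE Hx ->]; exists x.
Qed.

(** * Crossing and uncrossed sets at the level of base rings *)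

Lemma crossing_not_base_ring (K : fieldType) n (I J : {set 'I_n}) a b (w x y z : 'I_n)
    (E : 'X_{1..n} -> Prop) :
  (forall u, E u <-> two_bounds I J a b u) ->
  0 < a < n -> 0 < b < n ->
  w \in I -> w \in J -> x \in I -> x \notin J -> y \notin I -> y \in J ->
  z \notin I -> z \notin J ->
  ~ is_transversal_base_ring (monomial_subalgebra K E).
Proof.
move=> EP /andP[a0 an] /andP[b0 bn] wI wJ xI xJ yI yJ zI zJ [m [C [m2 C0 EC]]].
have n0 : 0 < n by apply: leq_trans an.
have Edeg u : E u -> mdeg u = n by case/EP.
have Enonempty : exists u, E u.
  exists (U_(z) *+ n)%MM; apply/EP; split.
  - by rewrite mdegMn mdeg1 mul1n.
  - by rewrite mass_MU (negPf zI).
  - by rewrite mass_MU (negPf zJ).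
have Cnonempty : exists u, transversal_exponents C u.
  pose j k := xchoose (set0Pn _ (C0 k)).
  by exists (\sum_(k < m) U_(j k))%MM, j => // k; apply: xchooseP.
have {}EC p : monomial_subalgebra K E p <->
    monomial_subalgebra K (transversal_exponents C) p.
  by split=> [/EC/base_ringE | /base_ringE/EC].
have CdegX := @transversal_mdeg _ _ C.
have m0 : 0 < m by apply: leq_trans m2.
have CE u : transversal_exponents C u <-> E u.
  split; [apply: (monomial_subalgebra_exponents m0 n0 CdegX Edeg Enonempty)
         |apply: (monomial_subalgebra_exponents n0 m0 Edeg CdegX Cnonempty)] => p.
    by split=> /EC.
  exact: EC.
(* A presentation may have any number [m] of sets; a common exponent has both degrees [m] and
   [n]. *)
have mn : m = n by have [u Eu] := Enonempty; rewrite -(Edeg u Eu) (CdegX u) //; apply/CE.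
subst m.
(* The obstruction supposes [a <= b]; otherwise [I] and [J] are exchanged, and [x] and [y] with
   them. *)
case: (leqP a b) => [ab|/ltnW ba].
  apply: (crossing_not_transversal a0 ab bn C0 wI wJ xI xJ yI yJ zI zJ) => u.
  exact: iff_trans (CE u) (EP u).
apply: (crossing_not_transversal b0 ba an C0 wJ wI yJ yI xJ xI zJ zI) => u.
exact: iff_trans (iff_trans (CE u) (EP u)) (two_boundsC _ _ _ _ _).
Qed.

Lemma uncrossed_base_ring (K : fieldType) n (I J : {set 'I_n}) a b
    (E : 'X_{1..n} -> Prop) :
  1 < n -> (forall u, E u <-> two_bounds I J a b u) ->
  #|I| < a <= n -> #|J| < b <= n ->
  [\/ J \subset I, I \subset J, [disjoint I & J] | I :|: J = setT] ->
  is_transversal_base_ring (monomial_subalgebra K E).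
Proof.
move=> n1 EP Ia Jb IJ.
have [C C0 CP] : exists2 C : 'I_n -> {set 'I_n}, forall k, C k != set0 &
    forall u, transversal_exponents C u <-> two_bounds I J a b u.
  have /andP[lIa an] := Ia; have /andP[lJb bn] := Jb.
  case: IJ => [JI|IJ|IJ|IJ].
  - by apply: transversal_nested => //; apply: leq_trans an.
  - have [C C0 CP] := transversal_nested IJ (leq_trans lJb bn) bn an.
    by exists C => // u; apply: iff_trans (CP u) (two_boundsC _ _ _ _ _).
  - by apply: transversal_separated => //; left.
  - by apply: transversal_separated => //; right.
exists n, C; split=> // p; apply: iff_trans _ (iff_sym (base_ringE C p)).
by apply: monomial_subalgebra_eq => u; apply: iff_trans (EP u) (iff_sym (CP u)).
Qed.

(** * Cyclic intervals and the numerical conditions *)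

Lemma sigma_expE n t (k : 'I_n) : (sigma n ^+ t)%g k = (k + t) %% n :> nat.
Proof.
elim: t => [|t IHt]; first by rewrite expg0 perm1 addn0 modn_small.
by rewrite expgSr permM permE /= IHt -addn1 modnDml addn1 addnS.
Qed.

(** Counting from 0, this is the cyclic interval of length [i] starting at [t]; the second disjunct
    is the part wrapped past [n - 1]. *)
Lemma in_sigma_initseg n t i (v : 'I_n) : t < n ->
  (v \in [set (sigma n ^+ t)%g j | j in initseg n i]) =
  (t <= v < t + i) || (v + n < t + i).
Proof.
move=> tn; have vE := sigma_expE t ((sigma n ^+ t)^-1%g v).
rewrite permKV in vE; rewrite -[v in LHS](permKV (sigma n ^+ t)%g).
rewrite (mem_imset _ _ perm_inj) inE; move: vE (ltn_ord ((sigma n ^+ t)^-1%g v)).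
move: (nat_of_ord ((sigma n ^+ t)^-1%g v)) => j vE jn; have vn := ltn_ord v.
case: (ltnP (j + t) n) => jt; first by rewrite modn_small // in vE; lia.
have {}vE : v = j + t - n :> nat.
  by rewrite vE -[in LHS](subnK jt) modnDr modn_small //; lia.
by lia.
Qed.

(** The last index lies outside [initseg n i], which gives the extra 1 in the mass bounds. *)
Lemma card_full_indices n i : i < n ->
  #|[set k : 'I_n | (k \in initseg n i) || (k.+1 == n)]| = i.+1.
Proof.
move=> lt_in; have n0 : n.-1 < n by lia.
have -> : [set k : 'I_n | (k \in initseg n i) || (k.+1 == n)] =
    Ordinal n0 |: initseg n i.
  apply/setP => k; rewrite !inE orbC; congr (_ || _).
  by rewrite -val_eqE /=; have := ltn_ord k; lia.
rewrite cardsU1 card_initseg ?(ltnW lt_in) // inE /=.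
by have -> : (n.-1 < i) = false by lia.
Qed.

Theorem theorem4p1 (K : fieldType) (n i1 i2 t2 : nat)
    (hn : 3 <= n) (hi1 : 1 <= i1 <= n - 2) (hi2 : 1 <= i2 <= n - 2)
    (ht2 : 0 <= t2 <= n - 1)
    (A B : 'I_n -> {set 'I_n})
    (hA : forall k : 'I_n,
      A k = if (k \in initseg n i1) || (k.+1 == n) then [set: 'I_n]
            else ~: initseg n i1)
    (hB : forall k : 'I_n,
      B ((sigma n ^+ t2)%g k) =
        if (k \in initseg n i2) || (k.+1 == n) then [set: 'I_n]
        else ~: [set (sigma n ^+ t2)%g j | j in initseg n i2]) :
  is_transversal_base_ring
    (monomial_subalgebra K
       (fun a => transversal_exponents A a /\ transversal_exponents B a)) <->
  i1 = 1
  \/ 2 <= i1 /\ t2 = 0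
  \/ 2 <= i1 /\ t2 = i1
  \/ [/\ 2 <= i1, 1 <= t2 <= i1 - 1 &
         1 <= i2 <= i1 - t2 \/ n - t2 <= i2 <= n - 2]
  \/ [/\ 2 <= i1, i1 + 1 <= t2 <= n - 1 &
         1 <= i2 <= n - t2 \/ n - t2 + i1 <= i2 <= n - 2].
Proof.
pose I := initseg n i1; pose J := [set (sigma n ^+ t2)%g j | j in initseg n i2].
have cardI : #|I| = i1 by rewrite card_initseg //; lia.
have cardJ : #|J| = i2 by rewrite card_imset ?card_initseg //; [lia | apply: perm_inj].
have inI v : (v \in I) = (v < i1) by rewrite inE.
have inJ v : (v \in J) = (t2 <= v < t2 + i2) || (v + n < t2 + i2).
  by apply: in_sigma_initseg; lia.
have AP u : transversal_exponents A u <-> mdeg u = n /\ mass I u <= i1.+1.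
  rewrite -(@card_full_indices n i1); last by lia.
  by apply: two_block_exponents => k; rewrite hA [in RHS]in_set.
have BP u : transversal_exponents B u <-> mdeg u = n /\ mass J u <= i2.+1.
  rewrite -(@card_full_indices n i2); last by lia.
  rewrite -(card_imset _ (@perm_inj _ (sigma n ^+ t2)%g)).
  apply: two_block_exponents => k; rewrite -[k](permKV (sigma n ^+ t2)%g).
  by rewrite hB (mem_imset _ _ perm_inj) [in RHS]in_set.
have EP u : transversal_exponents A u /\ transversal_exponents B u <->
    two_bounds I J i1.+1 i2.+1 u.
  split=> [[/AP[degu uI] /BP[_ uJ]]|[degu uI uJ]]; first by split.
  by split; [apply/AP | apply/BP].
have and3E P Q R : [/\ P, Q & R] <-> P /\ Q /\ R by split=> [[]|[? []]].
rewrite !and3E; split=> [H | cond]; last first.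
  apply: (uncrossed_base_ring K _ EP); rewrite ?cardI ?cardJ; try lia.
  have vn (v : 'I_n) := ltn_ord v.
  (* In order: [J] inside [I], [I] inside [J] (from the start, or by wrapping around), disjoint,
     covering. *)
  have [JI|[IJ|[[tI Jn]|[tI nJ]]]] : t2 + i2 <= i1 \/
      (t2 = 0 /\ i1 <= i2 \/ n - t2 + i1 <= i2) \/
      i1 <= t2 /\ t2 + i2 <= n \/ t2 <= i1 /\ n <= t2 + i2.
  - by lia.
  - by constructor 1; apply/subsetP => v; rewrite inI inJ; have := vn v; lia.
  - by constructor 2; apply/subsetP => v; rewrite inI inJ; have := vn v; lia.
  - constructor 3; rewrite disjoint_subset; apply/subsetP => v.
    by rewrite !inE -/J inJ; have := vn v; lia.
  - constructor 4; apply/setP => v; rewrite in_setU in_setT inI inJ.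
    by have := vn v; lia.
(* When all conditions fail, [J] either starts inside [I] after 0 and ends between [I] and [n - 1],
   or starts beyond [i1] and wraps around to end inside [I]. *)
have [//|cross] : (i1 = 1 \/ 2 <= i1 /\ t2 = 0 \/ 2 <= i1 /\ t2 = i1 \/
    (2 <= i1 /\ 1 <= t2 <= i1 - 1 /\
      (1 <= i2 <= i1 - t2 \/ n - t2 <= i2 <= n - 2)) \/
    (2 <= i1 /\ i1 + 1 <= t2 <= n - 1 /\
      (1 <= i2 <= n - t2 \/ n - t2 + i1 <= i2 <= n - 2))) \/
    (0 < t2 < i1 /\ i1 - t2 < i2 < n - t2 \/
      i1 < t2 /\ n - t2 < i2 < n - t2 + i1).
  by lia.
have H0 := crossing_not_base_ring EP _ _ _ _ _ _ _ _ _ _ H.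
have [p0 pi1 pi pt pn] : [/\ 0 < n, i1.-1 < n, i1 < n, t2 < n & n.-1 < n] by split; lia.
(* The witnesses [w], [x], [y], [z] are [t2], 0, [i1], [n - 1] in the first case and 0, [i1 - 1],
   [t2], [i1] in the second. *)
case: cross => [[t2i1 i2n]|[t2i1 i2n]].
  by case: (H0 (Ordinal pt) (Ordinal p0) (Ordinal pi) (Ordinal pn));
    rewrite ?inI ?inJ /=; lia.
by case: (H0 (Ordinal p0) (Ordinal pi1) (Ordinal pt) (Ordinal pi));
  rewrite ?inI ?inJ /=; lia.
Qed.
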